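(* Let $p_1$ and $p_2$ be two prime numbers such that $p_2\mid p_1-1$. Let $n$ be a positive integer. Let $Q$ be a non-degenerate quadratic form over $(\mathbb{Z}/(p_2))^n$. Let $f$ be an element of order $p_2$ of the orthogonal group defined by $Q$. Assume that we are given an element $\gamma$ of $(\mathbb{Z}/(p_1))^*$, a matrix $C\in GL_n(\mathbb{Z}/(p_2))$, and $z\in(\mathbb{Z}/(p_2))^n$ satisfying the properties (a) $\gamma$ has order $p_2$, and $C$ has order $p_1$; (b) $Q(c(\vec{x}))=Q(\vec{x})+z\cdot\vec{x}^t$ for all $\vec{x}\in(\mathbb{Z}/(p_2))^n$; (c) $FC=C^{\gamma}F$. Then there exists a left brace with additive group isomorphic to $\mathbb{Z}/(p_1)\times(\mathbb{Z}/(p_2))^{n+1}$, given by the lambda maps $$\lambda_{(a,\vec{x},x_{n+1})}:=\left(\gamma^{q(\vec{x},x_{n+1})},\;\begin{pmatrix} C & 0 \\ z & 1 \end{pmatrix}^{a}\begin{pmatrix} F^{q(\vec{x},x_{n+1})} & 0 \\ \vec{x}(C^t)^{-a}BF^{q(\vec{x},x_{n+1})} & 1 \end{pmatrix}\right)$$ for $a\in\mathbb{Z}/(p_1)$, $\vec{x}\in(\mathbb{Z}/(p_2))^n$, $x_{n+1}\in\mathbb{Z}/(p_2)$. In particular, for $p_2=2$, $n$ must be even, and for $p_2\neq 2$ we always have $z=0$. Moreover, this left brace is simple if and only if $$\operatorname{Im}(c-\operatorname{id})+\operatorname{Im}(f-\operatorname{id})=(\mathbb{Z}/(p_2))^n.$$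 In particular, a sufficient condition for it to be simple is that $c-\operatorname{id}$ is invertible.
   Context: A left brace is a set $B$ with two binary operations $+$ and $\cdot$ such that $(B,+)$ is an abelian group, $(B,\cdot)$ is a group, and $a\cdot(b+c)+a=a\cdot b+a\cdot c$ for all $a,b,c\in B$. Its lambda maps are $\lambda_a(b)=a\cdot b-a$, which are automorphisms of $(B,+)$. Saying that a left brace with a given additive group is given by lambda maps $\lambda$ means that its product is $a\cdot b=a+\lambda_a(b)$. An ideal of $B$ is a normal subgroup $I$ of $(B,\cdot)$ such that $\lambda_b(x)\in I$ for all $b\in B$, $x\in I$. A simple left brace is a non-zero left brace $B$ whose only ideals are $0$ and $B$. Notation. Elements of $(\mathbb{Z}/(p_2))^{n+1}$ are written $(\vec{x},x_{n+1})$ with $\vec{x}=(x_1,\dots,x_n)\in(\mathbb{Z}/(p_2))^n$ a row vector and $x_{n+1}\in\mathbb{Z}/(p_2)$; $t$ denotes transposition. Lower-case letters denote linear or bilinear maps on $(\mathbb{Z}/(p_2))^n$ and the corresponding capital letters their matrices with respect to the canonical basis: $F,C$ are the matrices of the linear maps $f,c$, so $f(\vec{x})=(F\vec{x}^t)^t$ and $c(\vec{x})=(C\vec{x}^t)^t$. The bilinear form associated with $Q$ is $b(\vec{x},\vec{y})=Q(\vec{x}+\vec{y})-Q(\vec{x})-Q(\vec{y})$, with matrix $B$, so $b(\vec{x},\vec{y})=\vec{x}B\vec{y}^t$; $Q$ is non-degenerate if $b$ is non-degenerate (i.e. $B$ is invertible). The orthogonal group of $Q$ is the group of linear automorphisms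 $g$ of $(\mathbb{Z}/(p_2))^n$ with $Q(g(\vec{x}))=Q(\vec{x})$ for all $\vec{x}$. Put $q(\vec{x},x_{n+1}):=x_{n+1}-Q(\vec{x})\in\mathbb{Z}/(p_2)$. The vector $z$ is a row vector. In the formula for $\lambda_{(a,\vec{x},x_{n+1})}$, the first component acts on $\mathbb{Z}/(p_1)$ by multiplication by $\gamma^{q(\vec{x},x_{n+1})}$, and the second component, an $(n+1)\times(n+1)$ matrix over $\mathbb{Z}/(p_2)$ in block form with block sizes $n$ and $1$, acts on $(\mathbb{Z}/(p_2))^{n+1}$ by multiplication on column vectors $(\vec{y},y_{n+1})^t$. Exponents that are residue classes ($a$ and $\gamma$ modulo $p_1$, $q(\vec{x},x_{n+1})$ modulo $p_2$) are evaluated on their least non-negative integer representatives. *)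

(* Defs.v *)
From HB Require Import structures.
From mathcomp Require Import all_boot all_order all_fingroup all_algebra.

Set Implicit Arguments.
Unset Strict Implicit.
Unset Printing Implicit Defensive.

Import GRing.Theory.
Local Open Scope ring_scope.

(** * Left braces *)

(* Left braces with additive group [A]. *)
Record left_brace (A : zmodType) := LeftBrace {
  brace_mul : A -> A -> A;
  brace_one : A;
  brace_inv : A -> A;
  brace_mulA : associative brace_mul;
  brace_mul1l : left_id brace_one brace_mul;
  brace_mul1r : right_id brace_one brace_mul;
  brace_mulVl : left_inverse brace_one brace_inv brace_mul;
  brace_mulVr : right_inverse brace_one brace_inv brace_mul;
  brace_distr : forall a b c : A,
    brace_mul a (b + c) + a = brace_mul a b + brace_mul a c }.

Definition brace_lambda (A : zmodType) (B : left_brace A) (a b : A) : A :=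
  brace_mul B a b - a.

Record brace_ideal (A : zmodType) (B : left_brace A) (I : A -> Prop) : Prop := {
  ideal_one : I (brace_one B);
  ideal_mul : forall x y, I x -> I y -> I (brace_mul B x y);
  ideal_inv : forall x, I x -> I (brace_inv B x);
  ideal_normal : forall b x, I x ->
    I (brace_mul B (brace_mul B b x) (brace_inv B b));
  ideal_lambda : forall b x, I x -> I (brace_lambda B b x) }.

Definition simple_brace (A : zmodType) (B : left_brace A) : Prop :=
  (exists x : A, x <> 0) /\
  (forall I : A -> Prop, brace_ideal B I ->
     (forall x, I x <-> x = 0) \/ (forall x, I x)).

(** * Quadratic forms *)

Section QuadraticForms.
Variables (K : fieldType) (n : nat).
Implicit Type Q : 'rV[K]_n -> K.

Definition polar Q (x y : 'rV[K]_n) : K := Q (x + y) - Q x - Q y.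

Definition quadratic_form Q : Prop :=
  (forall (a : K) (x : 'rV[K]_n), Q (a *: x) = a ^+ 2 * Q x) /\
  bilinear_for *%R *%R (polar Q).

Definition polar_mx Q : 'M[K]_n := matrix_of_form (polar Q).

Definition nondegenerate_form Q : bool := polar_mx Q \in unitmx.

(* Vectors are rows, but a matrix acts on them through column vectors. *)
Definition col_act (M : 'M[K]_n) (x : 'rV[K]_n) : 'rV[K]_n := (M *m x^T)^T.

Lemma col_act_is_linear (M : 'M[K]_n) : linear (col_act M).
Proof.
by move=> a x y; rewrite /col_act linearP linearP linearP.
Qed.

HB.instance Definition _ (M : 'M[K]_n) :=
  GRing.isLinear.Build K 'rV[K]_n 'rV[K]_n *:%R (col_act M)
    (col_act_is_linear M).

Definition col_end (M : 'M[K]_n) : 'End('rV[K]_n) := linfun (col_act M).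

End QuadraticForms.

Definition orthogonal_group (K : finFieldType) (n : nat)
    (Q : 'rV[K]_n.+1 -> K) : {set {'GL_n.+1[K]}} :=
  [set g : {'GL_n.+1[K]} | [forall x, Q (col_act g x) == Q x]].

(** * The lambda maps *)

Section LambdaMaps.
Variables (p1 p2 n : nat).

(* An element is (a, (x, x_{n+1})), the last coordinate being kept in the
   right 1-block of the row vector. *)
Definition brace_carrier : zmodType :=
  ('F_p1 * 'rV['F_p2]_(n.+1 + 1))%type.

Variables (Q : 'rV['F_p2]_n.+1 -> 'F_p2) (gamma : {unit 'F_p1}).
Variables (C F : 'M['F_p2]_n.+1) (z : 'rV['F_p2]_n.+1).

Definition q_fun (v : 'rV['F_p2]_(n.+1 + 1)) : 'F_p2 :=
  rsubmx v 0 0 - Q (lsubmx v).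

(* Exponents in ['F_p] are read through the coercion of ordinals to [nat],
   i.e. as least non-negative representatives. *)
Definition lambda_mx (a : 'F_p1) (v : 'rV['F_p2]_(n.+1 + 1)) :
    'M['F_p2]_(n.+1 + 1) :=
  block_mx C 0 z 1%:M ^+ a
  *m block_mx (F ^+ q_fun v) 0
              (lsubmx v *m (C^T) ^- a *m polar_mx Q *m F ^+ q_fun v) 1%:M.

Definition lambda_map (u w : brace_carrier) : brace_carrier :=
  (val gamma ^+ q_fun u.2 * w.1, col_act (lambda_mx u.1 u.2) w.2).

End LambdaMaps.

(* Main.v *)
(* In the coordinates (a, x, q) with q = x_{n+1} - Q(x), condition (b) says that
   the block matrix built from C and z preserves q, and the product becomes
     (a, x, q) (a', x', q') = (a + gamma^q a', x + C^a F^q x', q + q'),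
   the iterated semidirect product given by F C = C^gamma F.  Modulo
   W = Im(c - id) + Im(f - id) the x-coordinate is a homomorphism, whose kernel
   is an ideal.  Conversely, a non-zero ideal contains both the a-axis and the
   q-axis (through the non-degeneracy of b, gamma <> 1 and C <> 1), and then
   conjugating them by x puts all of W in it. *)

Require Import Defs.
From mathcomp Require Import all_boot all_order all_fingroup all_algebra.
From mathcomp Require Import ring.
From Stdlib Require Import Classical.

Set Implicit Arguments.
Unset Strict Implicit.
Unset Printing Implicit Defensive.

Import GRing.Theory Num.Theory.
Local Open Scope ring_scope.

(** * Matrices acting on column vectors *)

Lemma col_actM (K : fieldType) n (M N : 'M[K]_n) x :
  col_act (M *m N) x = col_act M (col_act N x).
Proof. by rewrite /col_act trmxK mulmxA. Qed.

Lemma col_act1 (K : fieldType) n (x : 'rV[K]_n) : col_act 1%:M x = x.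
Proof. by rewrite /col_act mul1mx trmxK. Qed.

(** * Quadratic forms, their polar forms, and parity in characteristic 2 *)

Section QuadraticForm.
Variables (K : fieldType) (n : nat) (Q : 'rV[K]_n -> K).
Hypothesis Q_quad : quadratic_form Q.

Lemma quad0 : Q 0 = 0.
Proof. by rewrite -(scale0r 0) Q_quad.1 expr0n mul0r. Qed.

Lemma quadN x : Q (- x) = Q x.
Proof. by rewrite -scaleN1r Q_quad.1 sqrrN expr1n mul1r. Qed.

Lemma quadD x y : Q (x + y) = Q x + Q y + polar Q x y.
Proof. by rewrite /polar; ring. Qed.

Lemma polarC x y : polar Q x y = polar Q y x.
Proof. by rewrite /polar (addrC y); ring. Qed.

Lemma polarPr x : linear_for *%R (polar Q x).
Proof. by move=> a y y'; rewrite (Q_quad.2.2 x a y y'). Qed.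

Lemma polarDr x : {morph polar Q x : y y' / y + y'}.
Proof. by move=> y y'; rewrite -{1}[y]scale1r polarPr mul1r. Qed.

Lemma polar0r x : polar Q x 0 = 0.
Proof. by apply: (addrI (polar Q x 0)); rewrite -polarDr !addr0. Qed.

Lemma polarZr x a : {morph polar Q x : y / a *: y >-> a * y}.
Proof. by move=> y; rewrite -[a *: y]addr0 polarPr polar0r addr0. Qed.

Lemma polar0l y : polar Q 0 y = 0.
Proof. by rewrite polarC polar0r. Qed.

Lemma polar_sumr I (r : seq I) x (E : I -> 'rV[K]_n) :
  polar Q x (\sum_(i <- r) E i) = \sum_(i <- r) polar Q x (E i).
Proof. exact: (big_morph _ (polarDr x) (polar0r x)). Qed.

Lemma polar_mxE x y : (x *m polar_mx Q *m y^T) 0 0 = polar Q x y.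
Proof.
rewrite [in RHS](row_sum_delta y) polar_sumr mxE; apply: eq_bigr => j _.
rewrite polarZr mulrC !mxE; congr (_ * _).
rewrite [in RHS](row_sum_delta x) polarC polar_sumr.
by apply: eq_bigr => i _; rewrite polarZr !mxE polarC.
Qed.

(** Invertibility of the Gram matrix makes [polar_mx Q *m y^T] non-zero, and its entries are the
    pairings of the basis vectors with [y]. *)
Lemma polar_exists y : nondegenerate_form Q -> y != 0 ->
  exists x, polar Q x y != 0.
Proof.
move=> ndQ y0; have : polar_mx Q *m y^T != 0.
  apply: contra y0 => /eqP By0; rewrite -trmx_eq0.
  by rewrite -[y^T](mulKmx ndQ) By0 mulmx0.
case/matrix0Pn=> i [j]; rewrite [j]ord1 => nz; exists 'e_i.
by rewrite -polar_mxE -mulmxA -rowE mxE.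
Qed.

End QuadraticForm.

(* An alternating matrix is the image of a skew-symmetric matrix of integers,
   so the characteristic 2 case is covered as well. *)
Lemma det_alternating_odd (R : comNzRingType) m (A : 'M[R]_m) (A' : 'M[int]_m) :
  odd m -> A'^T = - A' -> A = map_mx intr A' -> \det A = 0.
Proof.
move=> om skew ->; rewrite det_map_mx.
suff -> : \det A' = 0 by [].
have : \det A' = - \det A'.
  by rewrite -{1}det_tr skew -scaleN1r detZ -signr_odd om expr1 mulN1r.
by move/esym/eqP; rewrite eqNr => /eqP.
Qed.

(** In characteristic 2 the polar form is alternating, so in odd dimension its determinant
    vanishes. *)
Lemma nondeg_quad_F2_even m (Q : 'rV['F_2]_m -> 'F_2) :
  quadratic_form Q -> nondegenerate_form Q -> ~~ odd m.
Proof.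
move=> Qq; apply: contraL => om; rewrite /nondegenerate_form unitmxE.
have oppE (x : 'F_2) : - x = x by exact: oppr_pchar2.
(* Integer lift: representatives above the diagonal, their negatives below; the sign disappears
   modulo 2. *)
pose A' : 'M[int]_m := \matrix_(i, j)
  if (i < j)%N then (polar_mx Q i j : nat)%:Z
  else if (j < i)%N then - (polar_mx Q j i : nat)%:Z else 0.
rewrite (@det_alternating_odd _ _ _ A') ?unitr0 //.
  apply/matrixP=> i j; rewrite !mxE.
  by case: ltngtP; rewrite ?opprK ?oppr0.
apply/matrixP=> i j; rewrite [in RHS]mxE [A' i j]mxE.
have z (x : 'F_2) : (x : nat)%:~R = x :> 'F_2 by rewrite -pmulrn natr_Zp.
case: ltngtP => [_|_|/val_inj <-]; rewrite ?rmorphN /= ?z //.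
  by rewrite oppE !mxE (polarC Q).
(* On the diagonal [x + x = 0], so [polar Q x x] is [Q 0 - Q x - Q x], which is 0. *)
rewrite mxE /polar -{1}[X in Q (X + _)]scale1r -{2}['e_i]scale1r -scalerDl.
have -> : 1 + 1 = 0 :> 'F_2 by exact: val_inj.
by rewrite scale0r (quad0 Qq) -{2}(oppE (Q _)) sub0r subrr.
Qed.

(** * Left braces: lambda maps and ideals *)

Section LeftBrace.
Variables (A : zmodType) (B : left_brace A).
Implicit Types u v w : A.

Lemma brace_mulE u v : brace_mul B u v = u + brace_lambda B u v.
Proof. by rewrite addrC subrK. Qed.

Lemma brace_mulr0 u : brace_mul B u 0 = u.
Proof.
by have := brace_distr B u 0 0; rewrite addr0 => /addrI/esym.
Qed.

Lemma brace_one0 : brace_one B = 0.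
Proof. by rewrite -[RHS](brace_mul1l B) brace_mulr0. Qed.

Lemma brace_lambdaD u : {morph brace_lambda B u : v w / v + w}.
Proof.
move=> v w; apply: (addrI (u + u)); rewrite /brace_lambda.
have -> : u + u + (brace_mul B u (v + w) - u) = brace_mul B u (v + w) + u.
  by rewrite addrC -addrA addKr.
by rewrite brace_distr addrACA -!brace_mulE.
Qed.

(** This is associativity of the product, read through [brace_mulE] and the additivity of the lambda
    maps. *)
Lemma brace_lambdaM u v w :
  brace_lambda B (brace_mul B u v) w = brace_lambda B u (brace_lambda B v w).
Proof.
apply: (addrI (brace_mul B u v)); rewrite -brace_mulE -brace_mulA.
by rewrite [LHS]brace_mulE (brace_mulE v) brace_lambdaD addrA -brace_mulE.
Qed.

Lemma brace_lambda_inv u v :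
  brace_lambda B u (brace_lambda B (brace_inv B u) v) = v.
Proof.
by rewrite -brace_lambdaM brace_mulVr /brace_lambda brace_mul1l brace_one0
  subr0.
Qed.

Section Ideal.
Variable I : A -> Prop.
Hypothesis idI : brace_ideal B I.

Lemma brace_ideal0 : I 0.
Proof. by rewrite -brace_one0; exact: ideal_one idI. Qed.

(** The sum is the product of [u] with the preimage of [v] under the lambda map of [u]. *)
Lemma brace_idealD u v : I u -> I v -> I (u + v).
Proof.
move=> Iu Iv; rewrite -(brace_lambda_inv u v) -brace_mulE.
by apply: ideal_mul idI _ _ _ _ => //; apply: ideal_lambda idI _ _ _.
Qed.

Lemma brace_idealMn u k : I u -> I (u *+ k).
Proof.
move=> Iu; elim: k => [|k IHk]; first exact: brace_ideal0.
by rewrite mulrS; apply: brace_idealD.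
Qed.

Lemma brace_idealN u : I u -> I (- u).
Proof.
move=> Iu; have -> : - u = brace_lambda B u (brace_inv B u).
  by rewrite /brace_lambda brace_mulVr brace_one0 sub0r.
by apply: ideal_lambda idI _ _ _; apply: ideal_inv idI _ _.
Qed.

Lemma brace_idealB u v : I u -> I v -> I (u - v).
Proof. by move=> Iu Iv; apply: brace_idealD => //; apply: brace_idealN. Qed.

(** Conjugation written as an equation between two products, so that no inverse has to be computed
    in coordinates. *)
Lemma brace_ideal_conj b u v :
  I u -> brace_mul B v b = brace_mul B b u -> I v.
Proof.
move=> Iu e; suff -> : v = brace_mul B (brace_mul B b u) (brace_inv B b).
  exact: ideal_normal idI _ _ Iu.
by rewrite -e -brace_mulA brace_mulVr brace_mul1r.
Qed.

End Ideal.
End LeftBrace.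

(** * Exponents modulo a prime and metacyclic products *)

Section PrimeExponents.
Variables (p : nat) (p_pr : prime p).

Lemma val_FpD (a b : 'F_p) : (a + b)%R = ((a + b) %% p)%N :> nat.
Proof.
change ((a + b) %% (Zp_trunc (pdiv p)).+2 = (a + b) %% p)%N.
by move: (nat_of_ord a) (nat_of_ord b) => k l; rewrite (Fp_cast p_pr).
Qed.

Variables (gT : finGroupType) (g : gT).
Hypothesis g_order : #[g]%g = p.

Lemma expgFpD (a b : 'F_p) : (g ^+ (a + b)%R = g ^+ a * g ^+ b)%g.
Proof. by rewrite val_FpD expg_mod ?expgD // -g_order expg_order. Qed.

Lemma expgFp_nat (k : nat) : (g ^+ (k%:R : 'F_p) = g ^+ k)%g.
Proof. by rewrite val_Fp_nat // expg_mod // -g_order expg_order. Qed.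

End PrimeExponents.

Lemma prime_order_neq1 (gT : finGroupType) (g : gT) : prime #[g]%g -> g != 1%g.
Proof. by apply: contraTneq => ->; rewrite order1. Qed.

Section MetacyclicProduct.
Variables (p1 p2 : nat) (p1_prime : prime p1) (p2_prime : prime p2).
Variables (gT : finGroupType) (c f : gT) (gamma : 'F_p1).
Hypotheses (c_order : #[c]%g = p1) (f_order : #[f]%g = p2).
Hypothesis fc : (f * c = c ^+ gamma * f)%g.

(** The relation [fc] says that conjugation by [f^-1] raises [c] to the power [gamma]; each
    iteration multiplies exponents by [gamma]. *)
Lemma metacyclic_conj (a : 'F_p1) (l : nat) :
  ((c ^+ a) ^ (f ^- l) = c ^+ (gamma ^+ l * a)%R)%g.
Proof.
have cf : (c ^ f^-1 = c ^+ gamma)%g by rewrite conjgE invgK mulgA fc mulgK.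
have cfn (k : nat) : ((c ^+ k) ^ (f ^- l) = c ^+ (gamma ^ l * k)%N)%g.
  elim: l => [|l IHl]; first by rewrite expg0 invg1 conjg1 mul1n.
  by rewrite expgS invMg conjgM IHl conjXg cf -expgM mulnA -expnS.
by rewrite cfn -(expgFp_nat p1_prime c_order) natrM natrX !natr_Zp.
Qed.

Definition metacyclic_elt (a : 'F_p1) (q : 'F_p2) : gT := (c ^+ a * f ^+ q)%g.

(** Moving [f ^+ q] past [c ^+ b] scales [b] by [gamma ^+ q]. *)
Lemma metacyclic_eltM a b q r :
  (metacyclic_elt a q * metacyclic_elt b r =
   metacyclic_elt (a + gamma ^+ q * b) (q + r))%g.
Proof.
rewrite /metacyclic_elt (expgFpD p1_prime c_order) (expgFpD p2_prime f_order).
by rewrite -metacyclic_conj conjgE invgK !mulgA mulgKV.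
Qed.

Lemma metacyclic_elt00 : metacyclic_elt 0 0 = 1%g.
Proof. by rewrite /metacyclic_elt !expg0 mulg1. Qed.

Lemma metacyclic_elt10 : metacyclic_elt 1 0 = c.
Proof.
by rewrite /metacyclic_elt -(expgFp_nat p1_prime c_order 1) expg0 mulg1 expg1.
Qed.

Lemma metacyclic_elt01 : metacyclic_elt 0 1 = f.
Proof.
by rewrite /metacyclic_elt -(expgFp_nat p2_prime f_order 1) expg0 mul1g expg1.
Qed.

End MetacyclicProduct.

(** * The general linear group acting on vectors *)

Lemma trmxX (R : comNzRingType) m (A : 'M[R]_m.+1) k : (A ^+ k)^T = A^T ^+ k.
Proof.
elim: k => [|k IHk]; first by rewrite !expr0 trmx1.
by rewrite exprS exprSr -IHk; exact: trmx_mul.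
Qed.

Section LinearGroupAction.
Variables (K : finFieldType) (n : nat).
Implicit Types (g h : {'GL_n.+1[K]}) (x y : 'rV[K]_n.+1).

Definition gl_act g x : 'rV[K]_n.+1 := col_act (GLval g) x.

Lemma GL_XE g k : GLval (g ^+ k)%g = GLval g ^+ k.
Proof. exact: FinRing.val_unitX. Qed.

Lemma gl_act1 x : gl_act 1%g x = x.
Proof. by rewrite /gl_act GL_1E col_act1. Qed.

Lemma gl_actM g h x : gl_act (g * h)%g x = gl_act g (gl_act h x).
Proof. by rewrite /gl_act GL_MxE col_actM. Qed.

Lemma gl_actD g : {morph gl_act g : x y / x + y}.
Proof. exact: linearD. Qed.

Lemma gl_actN g : {morph gl_act g : x / - x}.
Proof. exact: linearN. Qed.

Lemma gl_act0 g : gl_act g 0 = 0.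
Proof. exact: linear0. Qed.

(** If all basis vectors were fixed, [g] would be the identity, whose order is not prime. *)
Lemma gl_act_neq1 g : prime #[g]%g -> exists x, x - gl_act g x != 0.
Proof.
move=> /prime_order_neq1 g1; apply/existsP; apply: contraR g1.
rewrite negb_exists => /forallP g1.
apply/eqP/val_inj/matrixP=> i j.
have e : ('e_j)^T = (gl_act g 'e_j)^T.
  by have := g1 'e_j; rewrite negbK subr_eq0 => /eqP <-.
move: e; rewrite /gl_act /col_act trmxK trmx_delta -colE => /matrixP/(_ i 0).
by rewrite !mxE => <-; rewrite eqxx andbT.
Qed.

Definition displacement g : {vspace 'rV[K]_n.+1} :=
  limg (col_end (GLval g) - \1%VF).

Lemma displacementP g y :
  reflect (exists x, y = gl_act g x - x) (y \in displacement g).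
Proof.
have E x : (col_end (GLval g) - \1%VF)%VF x = gl_act g x - x.
  by rewrite add_lfunE opp_lfunE id_lfunE lfunE.
apply: (iffP memv_imgP) => [[x _ ->]|[x ->]]; exists x;
  by rewrite ?E ?memvf.
Qed.

Lemma displacement_bij g :
  bijective (col_end (GLval g) - \1%VF) -> displacement g = fullv.
Proof.
case=> h _ hK; apply/eqP; rewrite eqEsubv subvf /=; apply/subvP=> y _.
by rewrite -(hK y) memv_img ?memvf.
Qed.

Section Stable.
Variable W : {vspace 'rV[K]_n.+1}.

Lemma displacement_sub g x : (displacement g <= W)%VS -> gl_act g x - x \in W.
Proof. by move/subvP; apply; apply/displacementP; exists x. Qed.

(** Telescoping: consecutive terms of [x, g x, g^2 x, ...] differ by elements of
    [displacement g]. *)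
Lemma displacement_subX g k :
  (displacement g <= W)%VS -> forall x, gl_act (g ^+ k)%g x - x \in W.
Proof.
move=> gW x; elim: k => [|k IHk]; first by rewrite expg0 gl_act1 subrr mem0v.
rewrite expgS gl_actM -(subrK (gl_act (g ^+ k)%g x) (gl_act g _)) -addrA.
rewrite memvD //.
exact: displacement_sub.
Qed.

Lemma displacement_metacyclic (p1 p2 : nat) g h (a : 'F_p1) (q : 'F_p2) x :
  (displacement g <= W)%VS -> (displacement h <= W)%VS ->
  gl_act (metacyclic_elt g h a q) x - x \in W.
Proof.
move=> gW hW; rewrite gl_actM.
rewrite -(subrK (gl_act (h ^+ q)%g x) (gl_act (g ^+ a)%g _)) -addrA.
by rewrite memvD //; apply: displacement_subX.
Qed.

End Stable.

(** * Invariance of the form and action of the lambda matrices *)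

Variables (Q : 'rV[K]_n.+1 -> K) (C F : {'GL_n.+1[K]}) (z : 'rV[K]_n.+1).
Hypotheses (Q_quad : quadratic_form Q) (F_orth : F \in orthogonal_group Q).
Hypothesis QC : forall x, Q (gl_act C x) = Q x + (z *m x^T) 0 0.

(** The correction term of (b) is linear in the vector, so it cancels in the polar form. *)
Lemma polar_C x y : polar Q (gl_act C x) (gl_act C y) = polar Q x y.
Proof.
by rewrite /polar -gl_actD !QC [(x + y)^T]linearD mulmxDr mxE; ring.
Qed.

Lemma polar_CX k x y :
  polar Q (gl_act (C ^+ k)%g x) (gl_act (C ^+ k)%g y) = polar Q x y.
Proof.
elim: k => [|k IHk]; first by rewrite expg0 !gl_act1.
by rewrite expgS !gl_actM polar_C.
Qed.

Lemma quad_FX k x : Q (gl_act (F ^+ k)%g x) = Q x.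
Proof.
move: F_orth; rewrite inE => /forallP QF.
elim: k => [|k IHk]; first by rewrite expg0 gl_act1.
by rewrite expgS gl_actM (eqP (QF _)).
Qed.

(* Condition (b) says that this block matrix preserves x_{n+1} - Q(x). *)
Lemma block_CX_act k y (s : K) :
  col_act (block_mx (GLval C) 0 z 1%:M ^+ k) (row_mx y (const_mx (s + Q y))) =
  row_mx (gl_act (C ^+ k)%g y) (const_mx (s + Q (gl_act (C ^+ k)%g y))).
Proof.
elim: k => [|k IHk]; first by rewrite expr0 expg0 gl_act1 col_act1.
rewrite exprS expgS gl_actM [LHS]col_actM IHk; move: (gl_act _ y) => w.
rewrite /col_act tr_row_mx mul_block_col tr_col_mx mul0mx addr0 mul1mx.
congr row_mx; apply/matrixP=> i j.
by rewrite !ord1 QC !mxE; ring.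
Qed.

(** The row [x (C^T)^-k] is [C^-k x]; as [C] preserves the polar form, pairing it with [F^l y] gives
    [polar Q x (C^k F^l y)]. The value of [Q] changes only through [C], which [block_CX_act]
    accounts for. *)
Lemma lambda_mx_act k l x y r :
  col_act (block_mx (GLval C) 0 z 1%:M ^+ k *m
           block_mx (GLval F ^+ l) 0
             (x *m (GLval C)^T ^- k *m polar_mx Q *m GLval F ^+ l) 1%:M)
    (row_mx y (const_mx (r + Q y))) =
  let y' := gl_act (C ^+ k * F ^+ l)%g y in
  row_mx y' (const_mx (r + polar Q x y' + Q y')).
Proof.
rewrite /= gl_actM col_actM -(quad_FX l y) -GL_XE.
set w := gl_act (F ^+ l)%g y; set w' := gl_act (C ^+ k)%g w.
have xC : x *m (GLval C)^T ^- k = gl_act (C ^- k)%g x.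
  rewrite /gl_act /col_act trmx_mul trmxK GL_VE GL_XE trmx_inv.
  by rewrite -trmxX.
have Fy : GLval (F ^+ l)%g *m y^T = w^T by rewrite /w /gl_act /col_act trmxK.
rewrite -block_CX_act; congr col_act.
rewrite /col_act tr_row_mx mul_block_col tr_col_mx mul0mx addr0 mul1mx Fy trmxK.
congr row_mx; rewrite -[_ *m y^T]mulmxA Fy xC; apply/matrixP=> i j.
rewrite !ord1 [LHS]mxE [LHS]mxE [X in X + _]polar_mxE // -(polar_CX k _ w).
rewrite -[gl_act _ (gl_act (C ^- k)%g x)]gl_actM.
by rewrite mulgV gl_act1 !mxE /w'; ring.
Qed.

(** Since [Q] is even, comparing (b) at [x] and [-x] shows that [z x^T] equals its opposite. *)
Lemma quad_shift_eq0 : 2%:R != 0 :> K -> z = 0.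
Proof.
move=> K2; have zx x : (z *m x^T) 0 0 = 0.
  have := QC (- x); rewrite gl_actN !(quadN Q_quad) QC => /addrI.
  rewrite linearN mulmxN [in RHS]mxE => /eqP.
  by rewrite -subr_eq0 opprK -mulr2n -mulr_natl mulf_eq0 (negPf K2) => /eqP.
apply/rowP=> i; have := zx 'e_i.
by rewrite trmx_delta -colE !mxE.
Qed.

End LinearGroupAction.

(** * The brace in the coordinates (a, x, q) *)

Section Construction.
Variables (p1 p2 n : nat) (p1_prime : prime p1) (p2_prime : prime p2).
Variable Q : 'rV['F_p2]_n.+1 -> 'F_p2.
Hypotheses (Q_quad : quadratic_form Q) (Q_nondeg : nondegenerate_form Q).
Variables (F C : {'GL_n.+1['F_p2]}) (gamma : {unit 'F_p1}).
Variable z : 'rV['F_p2]_n.+1.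
Hypotheses (F_orth : F \in orthogonal_group Q) (F_order : #[F]%g = p2).
Hypotheses (gamma_order : #[gamma]%g = p2) (C_order : #[C]%g = p1).
Hypothesis QC : forall x : 'rV['F_p2]_n.+1,
  Q (gl_act C x) = Q x + (z *m x^T) 0 0.
Hypothesis FC : (F * C = C ^+ (val gamma) * F)%g.

Notation carrier := (brace_carrier p1 p2 n).
Notation lambda := (lambda_map Q gamma C F z).

Definition lin_part (a : 'F_p1) (q : 'F_p2) :
    'rV['F_p2]_n.+1 -> 'rV['F_p2]_n.+1 :=
  gl_act (metacyclic_elt C F a q).

Lemma lin_partD a q : {morph lin_part a q : x y / x + y}.
Proof. exact: gl_actD. Qed.

Lemma lin_partN a q : {morph lin_part a q : x / - x}.
Proof. exact: gl_actN. Qed.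

Lemma lin_part0 a q : lin_part a q 0 = 0.
Proof. exact: gl_act0. Qed.

Lemma lin_partM a b q r x :
  lin_part a q (lin_part b r x) =
  lin_part (a + val gamma ^+ q * b) (q + r) x.
Proof.
rewrite /lin_part -gl_actM.
congr (gl_act _ x).
exact: (metacyclic_eltM p1_prime p2_prime C_order F_order FC).
Qed.

Lemma lin_part00 x : lin_part 0 0 x = x.
Proof. by rewrite /lin_part metacyclic_elt00 gl_act1. Qed.

Lemma gammaD (q r : 'F_p2) :
  val gamma ^+ (q + r)%R = val gamma ^+ q * val gamma ^+ r.
Proof.
by rewrite -!FinRing.val_unitX -FinRing.val_unitM
  -(expgFpD p2_prime gamma_order).
Qed.

(* The third coordinate is q(x, x_{n+1}), not x_{n+1}: in these coordinates the
   multiplicative group is an iterated semidirect product. *)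
Definition brace_elt (a : 'F_p1) x (q : 'F_p2) : carrier :=
  (a, row_mx x (const_mx (q + Q x))).

Lemma brace_elt_surj (u : carrier) :
  u = brace_elt u.1 (lsubmx u.2) (q_fun Q u.2).
Proof.
case: u => a v; rewrite /brace_elt /q_fun subrK; congr pair => /=.
rewrite -[LHS]hsubmxK; congr row_mx.
by apply/matrixP=> i j; rewrite !mxE !ord1.
Qed.

Lemma lsubmx_elt a x q : lsubmx (brace_elt a x q).2 = x.
Proof. exact: row_mxKl. Qed.

Lemma q_fun_elt a x q : q_fun Q (brace_elt a x q).2 = q.
Proof. by rewrite /q_fun row_mxKl row_mxKr mxE addrK. Qed.

(** The polar term measures the failure of q = x_{n+1} - Q(x) to be additive. *)
Lemma brace_eltD a b x y q r :
  brace_elt a x q + brace_elt b y r =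
  brace_elt (a + b) (x + y) (q + r - polar Q x y).
Proof.
rewrite [LHS]brace_elt_surj; congr brace_elt.
  by rewrite linearD /= !row_mxKl.
by rewrite /q_fun !linearD /= !row_mxKl !row_mxKr !mxE quadD; ring.
Qed.

Lemma lambda_elt a b x y q r :
  lambda (brace_elt a x q) (brace_elt b y r) =
  brace_elt (val gamma ^+ q * b) (lin_part a q y)
    (r + polar Q x (lin_part a q y)).
Proof.
rewrite /lambda_map /lambda_mx lsubmx_elt q_fun_elt /brace_elt /=.
congr pair; exact: (lambda_mx_act Q_quad F_orth QC).
Qed.

Lemma lambda_mapD u : {morph lambda u : v w / v + w}.
Proof.
move=> v w; rewrite /lambda_map /= mulrDr; congr pair.
exact: linearD.
Qed.

Definition metacyclic_mul (u w : carrier) : carrier := u + lambda u w.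

(** The polar term produced by [lambda] cancels the one produced by the addition, which leaves a
    semidirect product law. *)
Lemma metacyclic_mul_elt a b x y q r :
  metacyclic_mul (brace_elt a x q) (brace_elt b y r) =
  brace_elt (a + val gamma ^+ q * b) (x + lin_part a q y) (q + r).
Proof.
by rewrite /metacyclic_mul lambda_elt brace_eltD; congr brace_elt; ring.
Qed.

Lemma brace_elt0 : brace_elt 0 0 0 = 0.
Proof.
rewrite /brace_elt (quad0 Q_quad) addr0; congr pair.
by rewrite -row_mx0; congr row_mx; apply/matrixP => i j; rewrite !mxE.
Qed.

Lemma brace_elt_ind (P : carrier -> Prop) :
  (forall a x q, P (brace_elt a x q)) -> forall u, P u.
Proof. by move=> Pe u; rewrite (brace_elt_surj u). Qed.

(** A left inverse, solved from the product formula starting with the last coordinate. *)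
Definition metacyclic_inv (u : carrier) : carrier :=
  let q' := - q_fun Q u.2 in
  let a' := - (val gamma ^+ q' * u.1) in
  brace_elt a' (- lin_part a' q' (lsubmx u.2)) q'.

Lemma metacyclic_mulA : associative metacyclic_mul.
Proof.
elim/brace_elt_ind=> a x q; elim/brace_elt_ind=> b y r.
elim/brace_elt_ind=> c w s; rewrite !metacyclic_mul_elt.
rewrite lin_partD lin_partM gammaD mulrDr !addrA.
by rewrite mulrA.
Qed.

Lemma metacyclic_mul0r : left_id 0 metacyclic_mul.
Proof.
elim/brace_elt_ind=> a x q; rewrite -{1}brace_elt0 metacyclic_mul_elt.
by rewrite expr0 mul1r lin_part00 !add0r.
Qed.

Lemma metacyclic_mulr0 : right_id 0 metacyclic_mul.
Proof.
elim/brace_elt_ind=> a x q; rewrite -{1}brace_elt0 metacyclic_mul_elt.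
by rewrite mulr0 lin_part0 !addr0.
Qed.

Lemma metacyclic_mulVr : left_inverse 0 metacyclic_inv metacyclic_mul.
Proof.
elim/brace_elt_ind=> a x q; rewrite /metacyclic_inv q_fun_elt lsubmx_elt.
by rewrite metacyclic_mul_elt !addNr brace_elt0.
Qed.

Lemma metacyclic_mulrV : right_inverse 0 metacyclic_inv metacyclic_mul.
Proof.
elim/brace_elt_ind=> a x q; rewrite /metacyclic_inv q_fun_elt lsubmx_elt.
rewrite metacyclic_mul_elt lin_partN lin_partM mulrN mulrA -gammaD.
by rewrite subrr expr0 mul1r subrr lin_part00 subrr brace_elt0.
Qed.

Lemma metacyclic_distr u v w :
  metacyclic_mul u (v + w) + u = metacyclic_mul u v + metacyclic_mul u w.
Proof.
rewrite /metacyclic_mul lambda_mapD -[LHS]addrA [RHS]addrACA.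
by rewrite [_ + _ + u]addrC addrA.
Qed.

Definition metacyclic_brace : left_brace carrier :=
  LeftBrace metacyclic_mulA metacyclic_mul0r metacyclic_mulr0
    metacyclic_mulVr metacyclic_mulrV metacyclic_distr.

Lemma metacyclic_brace_lambda u w :
  brace_lambda metacyclic_brace u w = lambda u w.
Proof. by rewrite /brace_lambda /= /metacyclic_mul addrC addKr. Qed.

Notation B := metacyclic_brace.

(** * Non-zero ideals contain both axes *)

Section Simplicity.
Variable I : carrier -> Prop.
Hypotheses (idI : brace_ideal B I) (u : carrier) (Iu : I u) (u_neq0 : u <> 0).

Lemma brace_elt_mulrn a q k :
  brace_elt a 0 q *+ k = brace_elt (a *+ k) 0 (q *+ k).
Proof.
elim: k => [|k IHk]; first by rewrite !mulr0n brace_elt0.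
by rewrite !mulrS IHk brace_eltD polar0l // addr0 subr0.
Qed.

(** The additive multiples of a non-zero [t] exhaust Z/(p2); the multiplier is [r / t], read as a
    natural number. *)
Lemma ideal_q_axis t r : I (brace_elt 0 0 t) -> t != 0 -> I (brace_elt 0 0 r).
Proof.
move=> It t0; have := brace_idealMn idI (r / t : 'F_p2) It.
by rewrite brace_elt_mulrn mul0rn -mulr_natr natr_Zp mulrCA divff // mulr1.
Qed.

Lemma ideal_a_axis a b : I (brace_elt a 0 0) -> a != 0 -> I (brace_elt b 0 0).
Proof.
move=> Ia a0; have := brace_idealMn idI (b / a : 'F_p1) Ia.
by rewrite brace_elt_mulrn mul0rn -mulr_natr natr_Zp mulrCA divff // mulr1.
Qed.

(** Conjugation by (0, v, 0): both products in the conjugation equation are (a, v, q). This is how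
    the images of c - id and f - id enter an ideal. *)
Lemma ideal_conj_shift a q v :
  I (brace_elt a 0 q) -> I (brace_elt a (v - lin_part a q v) q).
Proof.
move=> Ia; apply: (brace_ideal_conj idI (b := brace_elt 0 v 0) Ia).
rewrite -[brace_mul B]/metacyclic_mul.
rewrite (metacyclic_mul_elt _ 0 _ v _ 0) (metacyclic_mul_elt 0 a v 0 0 q).
by rewrite mulr0 lin_part0 expr0 mul1r subrK !addr0 !add0r.
Qed.

Lemma gamma_sub1_neq0 : val gamma - 1 != 0.
Proof.
have: gamma != 1%g by apply: prime_order_neq1; rewrite gamma_order.
by apply: contra; rewrite subr_eq0 => /eqP g1; apply/eqP/val_inj.
Qed.

(* Apply lambda_(0, x, Q(x)), which only adds b(x, y) to the last coordinate. *)
Lemma ideal_polar a y q r :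
  I (brace_elt a y q) -> y != 0 -> I (brace_elt 0 0 r).
Proof.
move=> Iy y0; have [x xy0] := polar_exists Q_quad Q_nondeg y0.
apply: (@ideal_q_axis (polar Q x y)) => //.
have := brace_idealB idI (ideal_lambda idI (brace_elt 0 x 0) Iy) Iy.
rewrite metacyclic_brace_lambda lambda_elt expr0 mul1r lin_part00.
suff -> : brace_elt a y (q + polar Q x y) =
    brace_elt 0 0 (polar Q x y) + brace_elt a y q.
  by rewrite addrK.
by rewrite brace_eltD polar0l // subr0 !add0r (addrC q).
Qed.

(** Conjugating (0, 0, 1) by (1, 0, 0) gives (1 - gamma, 0, 1); subtracting leaves a non-zero point
    of the a-axis. *)
Lemma ideal_q_to_a b : I (brace_elt 0 0 1) -> I (brace_elt b 0 0).
Proof.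
move=> I1; apply: (@ideal_a_axis (1 - val gamma)).
  suff I2 : I (brace_elt (1 - val gamma) 0 1).
    have := brace_idealB idI I2 I1; congr I.
    apply/eqP; rewrite subr_eq brace_eltD polar0l //.
    by rewrite !addr0 subr0 add0r.
  apply: (brace_ideal_conj idI I1 (b := brace_elt 1 0 0)).
  rewrite -[brace_mul B]/metacyclic_mul.
  rewrite (metacyclic_mul_elt _ 1 0 0 1 0) (metacyclic_mul_elt 1 0 0 0 0 1).
  by rewrite !lin_part0 expr1 mulr1 mulr0 subrK !addr0 !add0r.
by rewrite -opprB oppr_eq0 gamma_sub1_neq0.
Qed.

(** Conjugating by a vector [v] moved by [C] creates the non-zero middle coordinate [v - C v], to
    which [ideal_polar] applies. *)
Lemma ideal_a_to_q r : I (brace_elt 1 0 0) -> I (brace_elt 0 0 r).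
Proof.
move=> /ideal_conj_shift Ic.
have [|v Cv] := @gl_act_neq1 _ _ C.
  by rewrite C_order.
apply: (@ideal_polar _ _ _ r (Ic v)).
by rewrite /lin_part (metacyclic_elt10 _ p1_prime).
Qed.

Lemma ideal_axes :
  (forall b, I (brace_elt b 0 0)) /\ (forall r, I (brace_elt 0 0 r)).
Proof.
(* Each axis yields the other, so reaching one of them from [u] is enough. *)
suff : I (brace_elt 1 0 0) \/ I (brace_elt 0 0 1).
  case=> [I1|I1]; last first.
    split=> [b|r]; first exact: ideal_q_to_a.
    exact: (ideal_q_axis r I1 (oner_neq0 _)).
  split=> [b|r]; last exact: ideal_a_to_q.
  exact: (ideal_a_axis b I1 (oner_neq0 _)).
move: Iu u_neq0; elim/brace_elt_ind: u => a y q Iu0 u0.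
have [y0|/(ideal_polar 1 Iu0)] := eqVneq y 0; last by right.
rewrite {}y0 in Iu0 u0.
have [a0|a0] := eqVneq a 0.
  right; rewrite {}a0 in Iu0 u0; apply: (ideal_q_axis 1 Iu0).
  by apply: contra_notN u0 => /eqP->; rewrite brace_elt0.
(* The lambda map of (0, 0, 1) sends (a, 0, q) to (gamma a, 0, q); the difference is ((gamma - 1) a,
   0, 0). *)
left; apply: (@ideal_a_axis ((val gamma - 1) * a)); last first.
  by rewrite mulf_neq0 // gamma_sub1_neq0.
have := brace_idealB idI (ideal_lambda idI (brace_elt 0 0 1) Iu0) Iu0.
rewrite metacyclic_brace_lambda lambda_elt expr1 lin_part0 polar0l // addr0.
congr I; apply/eqP; rewrite subr_eq brace_eltD polar0l // subr0 !add0r.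
by rewrite mulrBl mul1r subrK.
Qed.

(** With both axes in [I], membership depends on the middle coordinate alone, and the admissible
    ones are closed under addition. *)
Lemma ideal_full :
  (displacement C + displacement F)%VS = fullv ->
  forall w, I w.
Proof.
have [Ia Iq] := ideal_axes; move=> Wfull.
pose J x := I (brace_elt 0 x 0).
have JD x y : J x -> J y -> J (x + y).
  move=> Jx Jy.
  (* The added element of the q-axis cancels the polar correction. *)
  have := brace_idealD idI (brace_idealD idI Jx Jy) (Iq (polar Q x y)).
  by rewrite !brace_eltD polar0r // !addr0 !add0r subr0 addNr.
have JE a x q : I (brace_elt a x q) <-> J x.
  have e : brace_elt a x q =
      brace_elt a 0 0 + brace_elt 0 0 q + brace_elt 0 x 0.
    by do 2!rewrite brace_eltD polar0l // subr0 !(addr0, add0r).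
  have Iaq := brace_idealD idI (Ia a) (Iq q).
  split=> [|Jx]; rewrite e; last exact: brace_idealD idI _ _ _ _.
  by move=> /(brace_idealB idI)/(_ Iaq); rewrite addrC addKr.
have JC v : J (v - gl_act C v).
  have /JE := ideal_conj_shift v (Ia 1).
  by rewrite /lin_part (metacyclic_elt10 _ p1_prime).
have JF v : J (v - gl_act F v).
  have /JE := ideal_conj_shift v (Iq 1).
  by rewrite /lin_part (metacyclic_elt01 _ p2_prime).
elim/brace_elt_ind=> a x q; apply/JE.
have : x \in (displacement C + displacement F)%VS.
  by rewrite Wfull memvf.
case/memv_addP=> _ /displacementP[v ->] [_ /displacementP[w ->] ->].
(* [JC] and [JF] have the opposite sign to [displacementP], hence their use at [- v] and [- w]. *)
apply: JD.
  by have := JC (- v); rewrite gl_actN opprK addrC.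
by have := JF (- w); rewrite gl_actN opprK addrC.
Qed.

End Simplicity.

(** * The ideal attached to a subspace containing both displacements *)

Section Displacement.
Variable W : {vspace 'rV['F_p2]_n.+1}.
Hypotheses (CW : (displacement C <= W)%VS) (FW : (displacement F <= W)%VS).

(** The product adds [lin_part a q y] in place of [y], and the two agree modulo [W]. *)
Let mod_mul (u w : carrier) :
  lsubmx (brace_mul B u w).2 - (lsubmx u.2 + lsubmx w.2) \in W.
Proof.
elim/brace_elt_ind: u => a x q; elim/brace_elt_ind: w => b y r.
rewrite -[brace_mul B]/metacyclic_mul metacyclic_mul_elt !lsubmx_elt.
rewrite opprD addrACA subrr add0r.
exact: displacement_metacyclic.
Qed.

Let mod_mulP (u w : carrier) :
  (lsubmx (brace_mul B u w).2 \in W) = (lsubmx u.2 + lsubmx w.2 \in W).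
Proof.
by rewrite -[lsubmx (brace_mul _ _ _).2](subrK (lsubmx u.2 + lsubmx w.2))
  rpredDl ?mod_mul.
Qed.

(** A kernel of a homomorphism to an abelian group is normal; it is stable under lambda because [C]
    and [F] act trivially modulo [W]. *)
Lemma displacement_ideal : brace_ideal B (fun u => lsubmx u.2 \in W).
Proof.
have W0 : lsubmx (0 : carrier).2 \in W by rewrite linear0 mem0v.
split=> [|u w uW wW|u uW|b u uW|b u].
- exact: W0.
- by rewrite mod_mulP memvD.
- have h : lsubmx u.2 + lsubmx (brace_inv B u).2 \in W.
    by rewrite -mod_mulP brace_mulVr.
  by rewrite -(addKr (lsubmx u.2) (lsubmx _)) memvD // memvN.
- have h : lsubmx b.2 + lsubmx (brace_inv B b).2 \in W.
    by rewrite -mod_mulP brace_mulVr.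
  change (lsubmx (brace_mul B (brace_mul B b u) (brace_inv B b)).2 \in W).
  rewrite (mod_mulP (brace_mul B b u) (brace_inv B b)).
  rewrite -(subrK (lsubmx b.2 + lsubmx u.2) (lsubmx (brace_mul B b u).2)).
  by rewrite -addrA rpredDl ?mod_mul // addrAC rpredDr.
elim/brace_elt_ind: b => a x q; elim/brace_elt_ind: u => b y r.
rewrite metacyclic_brace_lambda lambda_elt !lsubmx_elt => yW.
rewrite -(subrK y (lin_part _ _ _)) memvD //.
exact: displacement_metacyclic.
Qed.

End Displacement.

Lemma metacyclic_brace_simple :
  simple_brace B <-> (displacement C + displacement F)%VS = fullv.
Proof.
split=> [[_ simpleB]|Wfull].
  have [CW FW] := (addvSl (displacement C) (displacement F),
                   addvSr (displacement C) (displacement F)).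
  (* The ideal contains (1, 0, 0), so it is not zero; being everything, it contains each (0, x,
     0). *)
  case: (simpleB _ (displacement_ideal CW FW)) => [I0|If].
    have /I0 /(congr1 fst) /= :
        lsubmx (brace_elt 1 0 0).2 \in (displacement C + displacement F)%VS.
      by rewrite lsubmx_elt mem0v.
    by move/eqP; rewrite oner_eq0.
  apply/eqP; rewrite eqEsubv subvf /=; apply/subvP => x _.
  by have := If (brace_elt 0 x 0); rewrite lsubmx_elt.
split=> [|I idI].
  exists (brace_elt 1 0 0) => /(congr1 fst) /= /eqP.
  by rewrite oner_eq0.
(* An ideal is an arbitrary predicate, so excluded middle decides whether it has a non-zero
   element. *)
case: (classic (exists2 u, I u & u <> 0)) => [[u Iu u0]|nI].
  by right; apply: (ideal_full idI Iu u0 Wfull).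
left=> u; split=> [Iu|->]; last exact: brace_ideal0 idI.
by apply: NNPP => u0; apply: nI; exists u.
Qed.

End Construction.

(* The positive integer n of the informal statement is n.+1 here. *)
Theorem theorem6p3 (p1 p2 n : nat)
  (p1_prime : prime p1) (p2_prime : prime p2) (p2_dvd : (p2 %| p1 - 1)%N)
  (Q : 'rV['F_p2]_n.+1 -> 'F_p2)
  (Q_quad : quadratic_form Q) (Q_nondeg : nondegenerate_form Q)
  (F : {'GL_n.+1['F_p2]})
  (F_orth : F \in orthogonal_group Q) (F_order : #[F]%g = p2)
  (gamma : {unit 'F_p1}) (C : {'GL_n.+1['F_p2]}) (z : 'rV['F_p2]_n.+1)
  (gamma_order : #[gamma]%g = p2) (C_order : #[C]%g = p1)
  (QC : forall x : 'rV['F_p2]_n.+1,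
     Q (col_act C x) = Q x + (z *m x^T) 0 0)
  (FC : (F * C = C ^+ (val gamma) * F)%g) :
  (exists B : left_brace (brace_carrier p1 p2 n),
     [/\ forall u w : brace_carrier p1 p2 n,
           brace_lambda B u w = lambda_map Q gamma C F z u w,
         simple_brace B <->
           (limg (col_end C - \1%VF) + limg (col_end F - \1%VF))%VS = fullv
       & bijective (col_end C - \1%VF) -> simple_brace B]) /\
  (p2 = 2%N -> ~~ odd n.+1) /\
  (p2 <> 2%N -> z = 0).
Proof.
split; last split.
- pose B := metacyclic_brace p1_prime p2_prime Q_quad F_orth F_order
    gamma_order C_order QC FC.
  have simpleB := metacyclic_brace_simple p1_prime p2_prime Q_quad Q_nondeg
    F_orth F_order gamma_order C_order QC FC.
  exists B; split=> [u w||bijC].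
  + exact: metacyclic_brace_lambda.
  + exact: simpleB.
  apply/simpleB/eqP; rewrite (displacement_bij bijC) eqEsubv subvf.
  exact: addvSl.
- move=> p22; move: Q Q_quad Q_nondeg {F_orth QC}; rewrite p22 => Q' Q'quad.
  exact: nondeg_quad_F2_even.
move=> p2n2; apply: (quad_shift_eq0 Q_quad QC).
(* 2 vanishes in ['F_p2] only if [p2] divides 2, that is, equals 2. *)
rewrite -(dvdn_pcharf (pchar_Fp p2_prime)) dvdn_prime2 //.
exact/eqP.
Qed.
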